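(* Let $R$ be a finite commutative ring with identity and let $n$ be a positive integer. If the Lie algebra $\mathfrak{sl}_n(R)$ admits an ODAC, then the characteristic $\operatorname{char}(R)$ is relatively prime to $n$.
   Context: $\mathfrak{sl}_n(R)$ is the Lie algebra over $R$ of $n\times n$ matrices over $R$ with trace $0$, with bracket $[A,B]=AB-BA$. Let $L$ be a Lie algebra over a finite commutative ring $R$ with identity that is free of finite rank as an $R$-module. A Cartan subalgebra of $L$ is a nilpotent subalgebra $H$ (an $R$-submodule closed under the bracket) that equals its normalizer $N_L(H)=\{x\in L : [x,H]\subseteq H\}$ in $L$. The Killing form of $L$ is $K(A,B)=\operatorname{Tr}(\operatorname{ad}A\cdot\operatorname{ad}B)$. An ODAC (orthogonal decomposition into abelian Cartan subalgebras) of $L$ is a direct sum decomposition of $R$-modules $L=H_0\oplus H_1\oplus\cdots\oplus H_k$ with $k\ge 0$, where the $H_i$ are abelian Cartan subalgebras of $L$ that are pairwise orthogonal with respect to the Killing form. *)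

(* Defs.v *)
From HB Require Import structures.
From mathcomp Require Import all_boot all_order all_algebra.
From mathcomp Require Import ring.

Set Implicit Arguments.
Unset Strict Implicit.
Unset Printing Implicit Defensive.

Import GRing.Theory.
Local Open Scope ring_scope.

(* Rings are "pz" (possibly zero) throughout, so that the zero ring, of
   characteristic 1, is allowed.  For this reason [vectType], which requires
   1 != 0 in the scalars, cannot be used for free modules. *)

Lemma ring_char_exists (R : finComPzRingType) :
  exists m, (0 < m)%N && (m%:R == 0 :> R).
Proof.
exists #|R|; apply/andP; split; first by apply/card_gt0P; exists 0.
apply/eqP/(@addrI _ (\sum_(x : R) x)).
rewrite addr0 -sumr_const -big_split /= [RHS](reindex_inj (addIr 1)).
by apply: eq_bigl => x.
Qed.

Definition ring_char (R : finComPzRingType) : nat :=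
  ex_minn (ring_char_exists R).

HB.mixin Record Lmodule_isLie (R : comPzRingType) L of GRing.Lmodule R L := {
  lie : L -> L -> L;
  lie_linearr : forall x, linear (lie x);
  lie_linearl : forall y, linear (lie^~ y);
  liexx : forall x, lie x x = 0;
  lie_jacobi : forall x y z,
    lie x (lie y z) + lie y (lie z x) + lie z (lie x y) = 0
}.

#[short(type="lieAlgType")]
HB.structure Definition LieAlgebra (R : comPzRingType) :=
  { L of GRing.Lmodule R L & Lmodule_isLie R L }.

(* A free module of finite rank, with a chosen basis and its coordinate
   functions; [ftrace_basis] below shows that the choice is immaterial. *)
HB.mixin Record Lmodule_isFiniteFree (R : pzRingType) V
    of GRing.Lmodule R V := {
  fbasis_index : finType;
  fbasis : fbasis_index -> V;
  fcoord : V -> fbasis_index -> R;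
  fcoordK : forall v, \sum_i fcoord v i *: fbasis i = v;
  fcoord_sum : forall (c : fbasis_index -> R) i,
    fcoord (\sum_j c j *: fbasis j) i = c i
}.

#[short(type="freeModType")]
HB.structure Definition FiniteFreeModule (R : pzRingType) :=
  { V of GRing.Lmodule R V & Lmodule_isFiniteFree R V }.

#[short(type="freeLieAlgType")]
HB.structure Definition FreeLieAlgebra (R : comPzRingType) :=
  { L of LieAlgebra R L & FiniteFreeModule R L }.

Section LieTheory.

Variables (R : comPzRingType) (L : freeLieAlgType R).
Implicit Types (H : {pred L}) (x y : L).

Definition ftrace (f : L -> L) : R :=
  \sum_(i : @fbasis_index R L) fcoord (f (fbasis i)) i.

Lemma fcoord_linear (i : @fbasis_index R L) :
  linear_for *%R (fun x : L => fcoord x i : R).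
Proof.
move=> a x y; rewrite -{1}(fcoordK x) -{1}(fcoordK y) scaler_sumr -big_split /=.
under eq_bigr => j _ do rewrite scalerA -scalerDl.
by rewrite (fcoord_sum (fun j => a * fcoord x j + fcoord y j)).
Qed.

Lemma ftrace_basis (f : {linear L -> L}) (I : finType) (b : I -> L)
    (c : L -> I -> R) :
  (forall x, \sum_i c x i *: b i = x) ->
  (forall (a : I -> R) i, c (\sum_j a j *: b j) i = a i) ->
  ftrace f = \sum_i c (f (b i)) i.
Proof.
move=> cK c_sum.
have lin_sum (J : finType) (g : L -> R) (h : J -> R) (e : J -> L) :
  linear_for *%R g -> g (\sum_j h j *: e j) = \sum_j h j * g (e j).
  move=> g_lin; have g0 : g 0 = 0.
    by have := g_lin (- 1) 0 0; rewrite scaler0 addr0 mulN1r addNr.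
  elim/big_rec2: _ => // j u v _ <-; exact: g_lin.
have c_lin i : linear_for *%R (c^~ i).
  move=> a x y; rewrite -{1}(cK x) -{1}(cK y) scaler_sumr -big_split /=.
  under eq_bigr => j _ do rewrite scalerA -scalerDl.
  by rewrite (c_sum (fun j => a * c x j + c y j)).
rewrite /ftrace.
transitivity (\sum_(i : @fbasis_index R L) \sum_j
    c (f (fbasis i)) j * fcoord (b j) i).
  by apply: eq_bigr => i _; rewrite -{1}(cK (f _)) (lin_sum _ _ _ _ (@fcoord_linear i)).
rewrite exchange_big; apply: eq_bigr => j _ /=.
rewrite -{2}(fcoordK (b j)) linear_sum /=.
under [in RHS]eq_bigr => i _ do rewrite linearZ /=.
rewrite (lin_sum _ _ _ _ (c_lin j)).
by apply: eq_bigr => i _; rewrite mulrC.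
Qed.

Definition killing x y : R := ftrace (lie x \o lie y).

Definition lie_subalgebra H : Prop :=
  submod_closed H /\ {in H &, forall x y, lie x y \in H}.

Definition lie_abelian H : Prop := {in H &, forall x y, lie x y = 0}.

Definition lie_normalizer H x : Prop := {in H, forall h, lie x h \in H}.

(* The submodule [A, B] spanned by the brackets of elements of A and B. *)
Inductive lie_span (A B : L -> Prop) : L -> Prop :=
| lie_span0 : lie_span A B 0
| lie_spanDZ (a : R) x y z :
    A x -> B y -> lie_span A B z -> lie_span A B (a *: lie x y + z).

Fixpoint lower_central H (m : nat) : L -> Prop :=
  if m is m'.+1 then lie_span (fun x => x \in H) (lower_central H m')
  else fun x => x \in H.

Definition lie_nilpotent H : Prop :=
  exists m, forall x, lower_central H m x -> x = 0.

Definition Cartan_subalgebra H : Prop :=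
  [/\ lie_subalgebra H, lie_nilpotent H
    & forall x, x \in H <-> lie_normalizer H x].

Definition direct_sum_decomposition (I : finType) (H : I -> {pred L}) : Prop :=
  (forall i, submod_closed (H i)) /\
  forall x, exists! h : {ffun I -> L},
    (forall i, h i \in H i) /\ x = \sum_i h i.

Definition is_ODAC (I : finType) (H : I -> {pred L}) : Prop :=
  [/\ direct_sum_decomposition H,
      forall i, Cartan_subalgebra (H i) /\ lie_abelian (H i)
    & forall i j, i != j -> {in H i & H j, forall x y, killing x y = 0}].

End LieTheory.

Definition has_ODAC (R : comPzRingType) (L : freeLieAlgType R) : Prop :=
  exists (k : nat) (H : 'I_k.+1 -> {pred L}), is_ODAC H.

Section SpecialLinear.

Variables (R : comPzRingType) (n : nat).

Definition trace0 : {pred 'M[R]_n} := fun A => \tr A == 0.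

Fact trace0_submod_closed : submod_closed trace0.
Proof.
split=> [|a A B]; first by rewrite unfold_in mxtrace0.
rewrite !unfold_in => /eqP trA /eqP trB.
by rewrite mxtraceD mxtraceZ trA trB mulr0 addr0.
Qed.

HB.instance Definition _ :=
  GRing.isSubmodClosed.Build R 'M[R]_n trace0 trace0_submod_closed.

Record sl := SL { slmx :> 'M[R]_n; _ : slmx \in trace0 }.

HB.instance Definition _ := [isSub for slmx].
HB.instance Definition _ := [Choice of sl by <:].
HB.instance Definition _ := [SubChoice_isSubLmodule of sl by <:].

Lemma mxtrace_commutator (A B : 'M[R]_n) : A *m B - B *m A \in trace0.
Proof. by rewrite unfold_in raddfB /= mxtrace_mulC subrr. Qed.

Definition sl_lie (A B : sl) : sl := SL (mxtrace_commutator A B).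

Fact sl_lie_linearr A : linear (sl_lie A).
Proof.
move=> a B C; apply: val_inj => /=.
rewrite mulmxDr mulmxDl -scalemxAr -scalemxAl scalerBr opprD.
by rewrite addrACA.
Qed.

Fact sl_lie_linearl B : linear (sl_lie^~ B).
Proof.
move=> a A C; apply: val_inj => /=.
rewrite mulmxDr mulmxDl -scalemxAr -scalemxAl scalerBr opprD.
by rewrite addrACA.
Qed.

Fact sl_liexx A : sl_lie A A = 0.
Proof. by apply: val_inj; rewrite /= subrr. Qed.

Fact sl_lie_jacobi A B C :
  sl_lie A (sl_lie B C) + sl_lie B (sl_lie C A) + sl_lie C (sl_lie A B) = 0.
Proof.
apply: val_inj; case: A B C => [A ?] [B ?] [C ?] /=.
rewrite !mulmxBr !mulmxBl !mulmxA !opprB.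
apply/matrixP => i j; rewrite !mxE; ring.
Qed.

HB.instance Definition _ := Lmodule_isLie.Build R sl
  sl_lie_linearr sl_lie_linearl sl_liexx sl_lie_jacobi.

Definition sl_index : finType :=
  {p : 'I_n * 'I_n | ~~ ((p.1.+1 == n) && (p.2.+1 == n))}.

(* E_ij for i <> j, and E_ii - E_ll for i = j, with l the last index *)
Definition sl_basis_mx (p : sl_index) : 'M[R]_n :=
  let: (i, j) := val p in
  delta_mx i j - (i == j)%:R *: \sum_(l : 'I_n | l.+1 == n) delta_mx l l.

Fact last_ord (i : 'I_n) : {l : 'I_n | (fun k : 'I_n => k.+1 == n) =1 pred1 l}.
Proof.
have lt_n : (n.-1 < n)%N by rewrite prednK // (leq_ltn_trans _ (ltn_ord i)).
exists (Ordinal lt_n) => k /=.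
rewrite -(inj_eq val_inj) /= -[in RHS]eqSS prednK //.
exact: leq_ltn_trans (ltn_ord i).
Qed.

Fact sl_basis_mx_trace0 p : sl_basis_mx p \in trace0.
Proof.
rewrite unfold_in /sl_basis_mx; case: p => [[i j] /= _].
have [l lastE] := last_ord i.
have trd (a b : 'I_n) : \tr (delta_mx a b : 'M[R]_n) = (a == b)%:R.
  rewrite /mxtrace (bigD1 a) //= big1 => [|k /negPf ka].
    by rewrite mxE eqxx addr0.
  by rewrite mxE ka.
by rewrite (big_pred1 l) // raddfB /= mxtraceZ !trd eqxx mulr1 subrr.
Qed.

Definition sl_basis (p : sl_index) : sl := SL (sl_basis_mx_trace0 p).

Definition sl_coord (A : sl) (p : sl_index) : R :=
  slmx A (val p).1 (val p).2.

Fact sl_coord_sum (c : sl_index -> R) p :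
  sl_coord (\sum_q c q *: sl_basis q) p = c p.
Proof.
rewrite /sl_coord -[slmx _]/(val _) raddf_sum /= summxE (bigD1 p) //=.
have coordE q : sl_basis_mx q (val p).1 (val p).2 = (p == q)%:R.
  rewrite /sl_basis_mx -(inj_eq val_inj); case: p q => [[r s] /= nl] [[i j] /= _].
  have [l lastE] := last_ord i.
  rewrite (big_pred1 l) // !mxE -xpair_eqE; case: eqVneq => [[? ?]|_] /=.
    by move: nl; rewrite !lastE /= => /negPf ->; rewrite mulr0 subr0.
  by move: nl; rewrite !lastE /= => /negPf ->; rewrite mulr0 subr0.
rewrite mxE coordE eqxx mulr1 big1 ?addr0 // => q neq_qp.
by rewrite mxE coordE eq_sym (negPf neq_qp) mulr0.
Qed.

Fact sl_coord_inj (A B : sl) : sl_coord A =1 sl_coord B -> A = B.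
Proof.
move=> eqAB; apply: val_inj; apply/matrixP => i j /=.
have [l lastE] := last_ord i.
have offE r s : (r, s) != (l, l) -> slmx A r s = slmx B r s.
  move=> nl.
  have nl' : ~~ ((r.+1 == n) && (s.+1 == n)) by rewrite !lastE /= -xpair_eqE.
  exact: (eqAB (exist _ (r, s) nl')).
have [[-> ->]|] := eqVneq (i, j) (l, l); last exact: offE.
case: A B {eqAB} offE => [A trA] [B trB] /= offE.
move: trA trB; rewrite !unfold_in => /eqP + /eqP trB; rewrite -{}trB.
rewrite /mxtrace !(bigD1 (P := xpredT) l) //=.
rewrite (eq_bigr (fun k => B k k)) => [/addIr //|k kl].
by rewrite offE // xpair_eqE (negPf kl).
Qed.

Fact sl_coordK (A : sl) : \sum_p sl_coord A p *: sl_basis p = A.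
Proof. by apply: sl_coord_inj => p; rewrite sl_coord_sum. Qed.

HB.instance Definition _ :=
  Lmodule_isFiniteFree.Build R sl sl_coordK sl_coord_sum.

End SpecialLinear.

(* Main.v *)
Require Import Defs.
From mathcomp Require Import all_boot all_order all_algebra.

(** If n and m = char(R) have gcd g > 1, then (m/g) I is a nonzero central
    element of sl_n(R).  A Cartan subalgebra, being self-normalizing, contains
    the center, so two distinct summands of a direct decomposition cannot both
    be Cartan subalgebras.  An ODAC would hence have a single summand, making
    sl_n(R) abelian, whereas the bracket of E_1n and E_n1 is E_11 - E_nn <> 0. *)

Set Implicit Arguments.
Unset Strict Implicit.
Unset Printing Implicit Defensive.

Import GRing.Theory.
Local Open Scope ring_scope.

Lemma ring_char_natr0 (R : finComPzRingType) : (ring_char R)%:R = 0 :> R.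
Proof. by rewrite /ring_char; case: ex_minnP => m /andP[_ /eqP]. Qed.

Lemma ring_char_gt0 (R : finComPzRingType) : (0 < ring_char R)%N.
Proof. by rewrite /ring_char; case: ex_minnP => m /andP[]. Qed.

Lemma ring_char_min (R : finComPzRingType) (m : nat) :
  (0 < m)%N -> m%:R = 0 :> R -> (ring_char R <= m)%N.
Proof.
rewrite /ring_char; case: ex_minnP => c _ c_min m_gt0 mR0.
by apply: c_min; rewrite m_gt0 mR0 eqxx.
Qed.

Definition lie_central (R : comPzRingType) (L : freeLieAlgType R) (z : L) :=
  forall x : L, lie z x = 0.

Lemma lie_central_Cartan (R : comPzRingType) (L : freeLieAlgType R)
    (H : {pred L}) (z : L) :
  Cartan_subalgebra H -> lie_central z -> z \in H.
Proof.
by move=> [[[H0 _] _] _ normH] zC; apply/normH => h _; rewrite zC.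
Qed.

(** Placing [z] in slot [i] or in slot [j], with zeros elsewhere, gives two decompositions of [z].
    Uniqueness equates them, and slot [i] then reads [z = 0]. *)
Lemma direct_sum_disjoint (R : comPzRingType) (L : freeLieAlgType R)
    (I : finType) (H : I -> {pred L}) (i j : I) (z : L) :
  direct_sum_decomposition H -> i != j -> z \in H i -> z \in H j -> z = 0.
Proof.
move=> [subH decH] neq_ij zi zj.
have [h [_ h_uniq]] := decH z.
have single k : z \in H k -> h = [ffun l => if l == k then z else 0].
  move=> zk; apply: h_uniq; split=> [l|].
    by rewrite ffunE; case: eqP => [->|_] //; case: (subH l).
  by under eq_bigr do rewrite ffunE; rewrite -big_mkcond big_pred1_eq.
have := congr1 (fun f : {ffun I -> L} => f i) (single i zi).
by rewrite (single j zj) !ffunE eqxx (negPf neq_ij).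
Qed.

Lemma ODAC_center_abelian (R : comPzRingType) (L : freeLieAlgType R) (z : L) :
  has_ODAC L -> lie_central z -> z != 0 -> forall x y : L, lie x y = 0.
Proof.
move=> [k [H [decH CartanH _]]] zC z_neq0 x y.
have Hz i : z \in H i by apply: lie_central_Cartan zC; case: (CartanH i).
(* A second index would make [z] a nonzero common element of two summands. *)
have single (i : 'I_k.+1) : i = ord0.
  apply/eqP; apply: contraT => i_neq0.
  by rewrite (direct_sum_disjoint decH i_neq0 (Hz i) (Hz ord0)) eqxx in z_neq0.
have full u : u \in H ord0.
  have [h [[Hh ->] _]] := decH.2 u.
  by rewrite (big_pred1 ord0) // => i; rewrite [i]single /= eqxx.
by have [_ abH] := CartanH ord0; apply: abH; apply: full.
Qed.

Lemma slmx0 (R : comPzRingType) (n : nat) : slmx (0 : sl R n) = 0.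
Proof. exact: (raddf0 (val : sl R n -> 'M[R]_n)). Qed.

Lemma scalar_mx_trace0 (R : comPzRingType) (n : nat) (a : R) :
  a *+ n = 0 -> (a%:M : 'M[R]_n) \in @trace0 R n.
Proof. by move=> an0; rewrite unfold_in mxtrace_scalar an0. Qed.

(** The hypothesis [a *+ n = 0] says that the scalar matrix of [a] has trace 0. *)
Lemma scalar_sl_central (R : comPzRingType) (n : nat) (a : R)
    (an0 : a *+ n = 0) :
  lie_central (SL (scalar_mx_trace0 an0)).
Proof. by move=> x; apply: val_inj; rewrite /= scalar_mxC subrr. Qed.

Lemma delta_mx_trace0 (R : comPzRingType) (n : nat) (i j : 'I_n) :
  i != j -> (delta_mx i j : 'M[R]_n) \in @trace0 R n.
Proof.
move=> neq_ij; rewrite unfold_in /mxtrace big1 // => k _; rewrite mxE.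
by case: eqP => // ->; rewrite (negPf neq_ij).
Qed.

Lemma sl_nonabelian (R : comPzRingType) (n : nat) :
  (1 < n)%N -> (1 : R) != 0 -> exists x y : sl R n, lie x y <> 0.
Proof.
case: n => [|[|n]] // _ R_neq0.
have neq01 : (ord0 : 'I_n.+2) != ord_max by [].
have neq10 : (ord_max : 'I_n.+2) != ord0 by [].
exists (SL (delta_mx_trace0 R neq01)), (SL (delta_mx_trace0 R neq10)).
(* The top left entry of the bracket is 1 - 0. *)
move=> /(congr1 (fun A : sl R n.+2 => slmx A ord0 ord0)).
rewrite slmx0 /= !mul_delta_mx !mxE /=.
by rewrite subr0 => /eqP; rewrite (negPf R_neq0).
Qed.

Theorem theorem2p5 (R : finComPzRingType) (n : nat) (n_gt0 : (0 < n)%N) :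
  has_ODAC (sl R n) -> coprime (ring_char R) n.
Proof.
move=> odac; apply: contraT; rewrite /coprime => gcd_neq1.
set g := gcdn (ring_char R) n in gcd_neq1.
have g_gt1 : (1 < g)%N by rewrite ltn_neqAle eq_sym gcd_neq1 gcdn_gt0 n_gt0 orbT.
have g_char : (g %| ring_char R)%N := dvdn_gcdl _ _.
have g_n : (g %| n)%N := dvdn_gcdr _ _.
have n_gt1 : (1 < n)%N := leq_trans g_gt1 (dvdn_leq n_gt0 g_n).
pose q := (ring_char R %/ g)%N.
(* Since [g > 1], [q] is positive and smaller than the characteristic, so minimality of the latter
   applies. *)
have q_neq0 : q%:R != 0 :> R.
  apply/eqP => /ring_char_min; rewrite divn_gt0 ?(ltnW g_gt1) //.
  rewrite dvdn_leq ?ring_char_gt0 // => /(_ isT).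
  by rewrite leqNgt ltn_Pdiv ?ring_char_gt0.
have qn0 : (q%:R : R) *+ n = 0.
  (* As integers, [q * n = (n / g) * ring_char R]. *)
  rewrite -mulrnA -(divnK g_n) mulnCA [(q * g)%N]divnK //.
  by rewrite mulnC mulrnA ring_char_natr0 mul0rn.
(* In the zero ring [q%:R] would vanish. *)
have R_neq0 : (1 : R) != 0.
  by apply: contra_neq q_neq0 => R0; rewrite -[q%:R]mulr1 R0 mulr0.
have z_neq0 : SL (scalar_mx_trace0 qn0) != 0.
  apply: contra_neq q_neq0.
  (* Since [n > 0] there is a diagonal entry to read, and it equals [q%:R]. *)
  move=> /(congr1 (fun A : sl R n => slmx A (Ordinal n_gt0) (Ordinal n_gt0))).
  by rewrite slmx0 !mxE eqxx.
have [x [y]] := sl_nonabelian n_gt1 R_neq0.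
by case; apply: ODAC_center_abelian odac (scalar_sl_central qn0) z_neq0 x y.
Qed.
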